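(* Fix $M,N\in\mathbb{N}$ and $\zeta,t\in(0,1)$. Let $\varnothing=\lambda(0)\prec\lambda(1)\prec\cdots\prec\lambda(M)$ be sampled from the homogeneous ascending Hall-Littlewood process $\mathbb{P}^{M,N}_\zeta$ with Hall-Littlewood parameter $t$. Then $(\lambda_1'(\cdot),\lambda_2'(\cdot),\dots,\lambda_N'(\cdot))$, viewed as a $\{1,\dots,N\}\times\llbracket0,M\rrbracket$-indexed discrete line ensemble $L_j(i)=\lambda_j'(i)$ (where $\lambda_j'(i)$ is the $j$-th part of the conjugate of $\lambda(i)$), satisfies the Hall-Littlewood Gibbs property with parameter $t$ for $S=\{1,\dots,M\}$.
   Context: A partition is a sequence $\lambda=(\lambda_1\ge\lambda_2\ge\cdots)$ of non-negative integers with finitely many non-zero terms; $|\lambda|=\sum_i\lambda_i$; the conjugate $\lambda'$ has parts $\lambda_i'=|\{j:\lambda_j\ge i\}|$; $m_i(\lambda)=|\{j:\lambda_j=i\}|$; $\varnothing$ is the partition of $0$. Write $\lambda\succ\mu$ (or $\mu\prec\lambda$) if $\lambda_1\ge\mu_1\ge\lambda_2\ge\mu_2\ge\cdots$ (equivalently $\lambda_j'-\mu_j'\in\{0,1\}$ for all $j\ge1$). Fix $t\in(0,1)$. $P_{\lambda/\mu},Q_{\lambda/\mu}$ are the skew Hall-Littlewood symmetric functions with parameter $t$ ($Q_\lambda=Q_{\lambda/\varnothing}$). In one variable, $P_{\lambda/\mu}(x)=\psi_{\lambda/\mu}(t)x^{|\lambda|-|\mu|}$, $Q_{\lambda/\mu}(x)=\phi_{\lambda/\mu}(t)x^{|\lambda|-|\mu|}$,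 with $\psi_{\lambda/\mu}(t)=\mathbf{1}_{\lambda\succ\mu}\prod_{j\in J}(1-t^{m_j(\mu)})$, $\phi_{\lambda/\mu}(t)=\mathbf{1}_{\lambda\succ\mu}\prod_{i\in I}(1-t^{m_i(\lambda)})$, $I=\{i\ge1:\lambda_{i+1}'=\mu_{i+1}',\lambda_i'>\mu_i'\}$, $J=\{j\ge1:\lambda_{j+1}'>\mu_{j+1}',\lambda_j'=\mu_j'\}$. In several variables, $Q_\lambda(x_1,\dots,x_N)=\sum\prod_{i=1}^NQ_{\nu(i)/\nu(i-1)}(x_i)$ over chains $\varnothing=\nu(0)\prec\cdots\prec\nu(N)=\lambda$; $Q_\lambda(\zeta^N)$ means all $N$ variables equal $\zeta$. Homogeneous ascending Hall-Littlewood process: the probability distribution on sequences $\varnothing=\lambda(0)\prec\lambda(1)\prec\cdots\prec\lambda(M)$ $$\mathbb{P}^{M,N}_\zeta(\lambda(1),\dots,\lambda(M))=\left(\frac{1-\zeta}{1-t\zeta}\right)^{NM}\prod_{i=1}^MP_{\lambda(i)/\lambda(i-1)}(1)\cdot Q_{\lambda(M)}(\zeta^N).$$ For integers $T_0<T_1$, $\llbracket T_0,T_1\rrbracket=\{T_0,\dots,T_1\}$. An up-right path on $\llbracket T_0,T_1\rrbracket$ is $\ell:\llbracket T_0,T_1\rrbracket\to\mathbb{Z}$ with $\ell(i+1)-\ell(i)\in\{0,1\}$. A $\{1,\dots,N\}\times\llbracket T_0,T_1\rrbracket$-indexed discrete line ensemble is a random $N$-tuple $(L_1,\dots,L_N)$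 of up-right paths on $\llbracket T_0,T_1\rrbracket$. Weight: for paths $\ell,f,g$ on $\llbracket T_0,T_1\rrbracket$ ($f=\infty$ allowed) and $S\subset\llbracket T_0+1,T_1\rrbracket$, with $\Delta^+=f-\ell$, $\Delta^-=\ell-g$, $$W_t(T_0,T_1,\ell,f,g;S)=\prod_{i\in S}\left(1-\mathbf{1}_{\{\Delta^+(i-1)-\Delta^+(i)=1\}}t^{\Delta^+(i-1)}\right)\prod_{i\in S}\left(1-\mathbf{1}_{\{\Delta^-(i-1)-\Delta^-(i)=1\}}t^{\Delta^-(i-1)}\right)$$ if $f(i)\ge\ell(i)\ge g(i)$ for all $i\in S$, and $0$ otherwise; if $f=\infty$ the first product is $1$. Hall-Littlewood Gibbs property with parameter $t$ for $S$: with the convention $L_0=\infty$, for every $i\in\{1,\dots,N-1\}$ and all paths $\ell_{i-1},\ell_{i+1}$ ($\ell_0=\infty$ if $i=1$) and integers $a,b$ for which the conditioning event below has positive probability, and every up-right path $\ell$ with $\ell(T_0)=a$, $\ell(T_1)=b$, $$\mathbb{P}(L_i=\ell\mid L_i(T_0)=a,L_i(T_1)=b,L_{i-1}=\ell_{i-1},L_{i+1}=\ell_{i+1})=\frac{W_t(T_0,T_1,\ell,\ell_{i-1},\ell_{i+1};S)}{Z},$$ where $Z$ is the normalization constant (depending on $T_0,T_1,a,b,\ell_{i-1},\ell_{i+1},S$ but not on $\ell$) making the right side a probability distribution in $\ell$. (For $N=1$ the property is vacuous.) *)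

(* Defs.v *)
From HB Require Import structures.
From mathcomp Require Import all_boot all_order all_algebra.
From mathcomp Require Import all_classical all_reals all_analysis.
Set Implicit Arguments.
Unset Strict Implicit.
Unset Printing Implicit Defensive.
Import Order.TTheory GRing.Theory Num.Theory.
Local Open Scope classical_set_scope.
Local Open Scope ring_scope.

(* A partition is stored as the non-increasing list of its non-zero parts. *)
Record intpart := IntPart {
  parts :> seq nat;
  _ : sorted geq parts && (0%N \notin parts) }.
HB.instance Definition _ := [isSub for parts].
HB.instance Definition _ := [Countable of intpart by <:].

Definition part_empty : intpart := @IntPart [::] isT.

(* Parts, conjugate parts and multiplicities are indexed by positive
   integers; the value at index 0 is irrelevant. *)
Definition part (la : intpart) (j : nat) : nat := nth 0%N la j.-1.
Definition weight (la : intpart) : nat := sumn la.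
Definition conj_part (la : intpart) (i : nat) : nat :=
  count (fun p => i <= p)%N la.
Definition mult (la : intpart) (i : nat) : nat := count_mem i la.

Definition interlace (mu la : intpart) : Prop :=
  forall j : nat, (0 < j)%N ->
    (part mu j <= part la j)%N /\ (part la j.+1 <= part mu j)%N.

Section HallLittlewood.
Variables (R : realType) (t : R).

Definition HL_I (la mu : intpart) : set nat :=
  [set i | (1 <= i)%N /\ conj_part la i.+1 = conj_part mu i.+1 /\
           (conj_part la i > conj_part mu i)%N].

Definition HL_J (la mu : intpart) : set nat :=
  [set j | (1 <= j)%N /\ (conj_part la j.+1 > conj_part mu j.+1)%N /\
           conj_part la j = conj_part mu j].

Definition HL_phi (la mu : intpart) : R :=
  `[< interlace mu la >]%:R *
  \big[*%R/1]_(i \in HL_I la mu) (1 - t ^+ mult la i).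

Definition HL_psi (la mu : intpart) : R :=
  `[< interlace mu la >]%:R *
  \big[*%R/1]_(j \in HL_J la mu) (1 - t ^+ mult mu j).

(* The truncated subtraction is harmless: [HL_psi] and [HL_phi] vanish unless
   [mu] is contained in [la]. *)
Definition HL_P1 (la mu : intpart) (x : R) : R :=
  HL_psi la mu * x ^+ (weight la - weight mu).

Definition HL_Q1 (la mu : intpart) (x : R) : R :=
  HL_phi la mu * x ^+ (weight la - weight mu).

(* A sequence nu(1), ..., nu(n) is a tuple; [step nu k] is nu(k), where
   nu(0) is the empty partition. *)
Definition step (n : nat) (nu : n.-tuple intpart) (k : nat) : intpart :=
  nth part_empty (part_empty :: nu) k.

Definition chain (n : nat) (nu : n.-tuple intpart) : Prop :=
  forall k : nat, (k < n)%N -> interlace (step nu k) (step nu k.+1).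

(* The variable x_(k+1) is [x k]. *)
Definition HL_Q (n : nat) (la : intpart) (x : 'I_n -> R) : R :=
  \sum_(nu \in [set nu : n.-tuple intpart | chain nu /\ step nu n = la])
    \prod_(k < n) HL_Q1 (step nu k.+1) (step nu k) (x k).

Definition HL_process_pmf (M N : nat) (zeta : R) (la : M.-tuple intpart) : R :=
  ((1 - zeta) / (1 - t * zeta)) ^+ (N * M) *
  \prod_(i < M) HL_P1 (step la i.+1) (step la i) 1 *
  HL_Q (step la M) (fun _ : 'I_N => zeta).

End HallLittlewood.

Definition HL_process_sample (R : realType) (t : R) (d : measure_display)
    (T : measurableType d) (P : probability T R) (M N : nat) (zeta : R)
    (lam : T -> M.-tuple intpart) : Prop :=
  (forall w : T, chain (lam w)) /\
  forall la : M.-tuple intpart, chain la ->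
    measurable [set w | lam w = la] /\
    P [set w | lam w = la] = (HL_process_pmf t N zeta la)%:E.

Definition zinterval (T0 T1 : int) : set int := [set k | T0 <= k <= T1].

(* A function on the integer interval from T0 to T1 is represented by its
   extension by 0 to all integers, so that equality of paths is Leibniz
   equality. *)
Definition upright_path (T0 T1 : int) : set (int -> int) :=
  [set l | (forall k : int, T0 <= k < T1 ->
              l (k + 1) - l k = 0 \/ l (k + 1) - l k = 1)
           /\ (forall k : int, ~ zinterval T0 T1 k -> l k = 0)].

Definition path_bridge (T0 T1 a b : int) : set (int -> int) :=
  [set l | upright_path T0 T1 l /\ l T0 = a /\ l T1 = b].

(* The curves are [L 1], ..., [L N]; other indices are irrelevant. *)
Definition discrete_line_ensemble (d : measure_display) (T : measurableType d)
    (N : nat) (T0 T1 : int) (L : nat -> T -> int -> int) : Prop :=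
  forall j : nat, (1 <= j <= N)%N ->
    (forall w, upright_path T0 T1 (L j w)) /\
    (forall k m : int, measurable [set w | L j w k = m]).

Section Gibbs.
Variables (R : realType) (t : R).

Definition HL_weight_factor (D : int -> int) (i : int) : R :=
  1 - (D (i - 1) - D i == 1)%:R * t ^ D (i - 1).

(* [f = None] stands for the upper curve being +oo; [T0] and [T1] enter only
   through the requirement that S lies between T0 + 1 and T1. *)
Definition HL_weight (l : int -> int) (f : option (int -> int))
    (g : int -> int) (S : set int) : R :=
  if `[< forall i : int, S i ->
          (if f is Some f' then l i <= f' i else True) /\ g i <= l i >]
  then
    (if f is Some f' then
       \big[*%R/1]_(i \in S) HL_weight_factor (fun k => f' k - l k) i
     else 1) *
    \big[*%R/1]_(i \in S) HL_weight_factor (fun k => l k - g k) i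
  else 0.

Definition HL_partition_function (T0 T1 a b : int) (f : option (int -> int))
    (g : int -> int) (S : set int) : R :=
  \sum_(l \in path_bridge T0 T1 a b) HL_weight l f g S.

Definition cond_prob (d : measure_display) (T : measurableType d)
    (P : probability T R) (A B : set T) : R :=
  fine (P (A `&` B)) / fine (P B).

Definition curve (T : Type) (L : nat -> T -> int -> int) (j : nat) (w : T) :
    option (int -> int) :=
  if j is 0%N then None else Some (L j w).

Definition HL_Gibbs (d : measure_display) (T : measurableType d)
    (P : probability T R) (N : nat) (T0 T1 : int) (L : nat -> T -> int -> int)
    (S : set int) : Prop :=
  forall (i : nat) (f : option (int -> int)) (g : int -> int) (a b : int),
    (1 <= i <= N - 1)%N ->
    (if f is Some f' then (i != 1)%N /\ upright_path T0 T1 f'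
     else i = 1%N) ->
    upright_path T0 T1 g ->
    let B := [set w | L i w T0 = a /\ L i w T1 = b /\
                      curve L i.-1 w = f /\ L i.+1 w = g] in
    (0 < P B)%E ->
    forall l : int -> int, path_bridge T0 T1 a b l ->
      cond_prob P [set w | L i w = l] B =
      HL_weight l f g S / HL_partition_function T0 T1 a b f g S.

End Gibbs.

Definition conj_ensemble (T : Type) (M : nat) (lam : T -> M.-tuple intpart)
    (j : nat) (w : T) : int -> int :=
  fun k : int =>
    if 0 <= k <= M%:Z then (conj_part (step (lam w) `|k|%N) j)%:Z else 0.

(* Main.v *)
Require Import Defs.
From mathcomp Require Import all_boot all_order all_algebra.
From mathcomp Require Import all_classical all_reals all_analysis.
From mathcomp Require Import zify ring.
Import Order.TTheory GRing.Theory Num.Theory.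
Local Open Scope classical_set_scope.
Local Open Scope ring_scope.

(** In terms of the curves [L_j(k) = lambda'_j(k)], interlacing says that each
    curve moves by 0 or 1 at each step, and [psi] at step [k] is the product
    over [j] of the weight factors of [L_j - L_(j+1)] at [k]. Since the [Q]
    factor only sees the endpoint [lambda(M)], resampling [L_i] with fixed
    endpoints changes the probability of a sequence only through the factors
    involving [L_(i-1) - L_i] and [L_i - L_(i+1)], which form the Gibbs weight.
    Replacing [L_i = l] by [L_i = l'] while keeping all other curves is a
    bijection of the corresponding countable sets of sequences, so the
    probabilities of [L_i = l] and [L_i = l'] are in the ratio of their weights;
    this determines the conditional law on the finite set of bridges. *)

(** * Conjugate partitions and interlacing *)

Lemma leq_count_sorted (s : seq nat) (j r : nat) : (0 < j)%N ->
  sorted geq s -> (r < count (fun p => j <= p) s)%N = (j <= nth 0 s r)%N.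
Proof.
move=> j0; elim: s r => [|x s IH] r hs; first by rewrite nth_nil ltn0; lia.
have {}IH r' := IH r' (path_sorted hs).
have /allP xs : all (geq x) s.
  by apply: order_path_min hs => a b c /= ab bc; exact: leq_trans bc ab.
rewrite /=; case: (leqP j x) => [jx|xj]; first by case: r => [|r] //=; rewrite -IH.
have -> : count (fun p => j <= p)%N s = 0%N.
  by apply/eqP; rewrite -leqn0 leqNgt -has_count; apply/hasPn => y /xs /=; lia.
rewrite /= addn0 ltn0; case: r => [|r] /=; first by rewrite leqNgt xj.
case: (ltnP r (size s)) => [/(mem_nth 0%N) /xs /=|/(nth_default 0%N) ->]; lia.
Qed.

(** Both inequalities say that the box in row [r] and column [j] lies in the Young diagram. All
    transfers between parts and conjugate parts go through this equivalence. *)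
Lemma leq_conj_part (la : intpart) (j r : nat) : (0 < j)%N -> (0 < r)%N ->
  (r <= conj_part la j)%N = (j <= part la r)%N.
Proof.
case: la r => s ps [|r] // j0 _; have /andP[hs _] := ps.
exact: leq_count_sorted.
Qed.

Lemma conj_part_le (la : intpart) (i j : nat) : (i <= j)%N ->
  (conj_part la j <= conj_part la i)%N.
Proof. by move=> ij; apply: sub_count => p /=; lia. Qed.

Lemma conj_partE (la : intpart) (j : nat) :
  conj_part la j = (conj_part la j.+1 + mult la j)%N.
Proof.
rewrite /mult /conj_part -count_predUI -[LHS]addn0; congr addn.
  by apply: eq_count => p /=; lia.
rewrite -[LHS](count_pred0 la); apply: eq_count => p /=; lia.
Qed.

(** Differences of consecutive conjugate parts are the multiplicities, and a sorted list is
    determined by its multiplicities. *)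
Lemma conj_part_inj (la mu : intpart) :
  (forall j, (0 < j)%N -> conj_part la j = conj_part mu j) -> la = mu.
Proof.
move=> h; apply: val_inj.
have [/andP[sl nl] /andP[sm nm]] := (valP la, valP mu).
apply: (@sorted_eq _ geq) => //.
- by move=> a b c /= ab bc; exact: leq_trans bc ab.
- by move=> a b /andP[/= ab ba]; apply/eqP; rewrite eqn_leq ab ba.
(* Nothing is assumed about index 0; there both multiplicities vanish because 0 is not a part. *)
apply/allP => j _ /=; case: j => [|j].
  by rewrite (count_memPn nl) (count_memPn nm).
have := conj_partE la j.+1; rewrite h // conj_partE h // => /eqP.
by rewrite eqn_add2l eq_sym.
Qed.

Lemma interlace_conj (mu la : intpart) : interlace mu la <->
  forall j, (0 < j)%N -> (conj_part mu j <= conj_part la j <= (conj_part mu j).+1)%N.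
Proof.
split=> h j j0.
  apply/andP; split.
    case E : (conj_part mu j) => [//|r].
    have := leq_conj_part mu j r.+1 j0 isT; rewrite E leqnn => /esym hr.
    rewrite leq_conj_part //; apply: leq_trans hr _; exact: (h r.+1 isT).1.
  case E : (conj_part la j) => [//|[//|r]].
  have := leq_conj_part la j r.+2 j0 isT; rewrite E leqnn => /esym hr.
  rewrite ltnS leq_conj_part //; apply: leq_trans hr _; exact: (h r.+1 isT).2.
split.
  case E : (part mu j) => [//|r].
  rewrite -leq_conj_part //; have /andP[+ _] := h r.+1 isT; apply: leq_trans.
  by rewrite leq_conj_part // E.
case E : (part la j.+1) => [//|r].
rewrite -leq_conj_part // -ltnS; have /andP[_] := h r.+1 isT; apply: leq_trans.
by rewrite leq_conj_part // E.
Qed.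

(** Take each [j] from 1 to [K] with multiplicity [c j - c j.+1]; the number of parts that are at
    least [j] then telescopes to [c j]. *)
Lemma exists_conj_part (c : nat -> nat) (K : nat) :
  (forall j, (0 < j)%N -> (c j.+1 <= c j)%N) -> (forall j, (K < j)%N -> c j = 0%N) ->
  exists la, forall j, (0 < j)%N -> conj_part la j = c j.
Proof.
move=> cd c0.
pose s := sort geq (flatten [seq nseq (c j - c j.+1) j | j <- index_iota 1 K.+1]).
have ps : sorted geq s && (0%N \notin s).
  rewrite sort_sorted /=; last by move=> a b /=; lia.
  rewrite mem_sort; apply/negP => /flatten_mapP[j]; rewrite mem_index_iota.
  by rewrite mem_nseq => /andP[j1 _] /andP[_ /eqP e]; rewrite -e in j1.
exists (@IntPart s ps) => j j0; rewrite /conj_part /= count_sort.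
rewrite count_flatten -map_comp sumnE big_map.
under eq_bigr do rewrite /= count_nseq.
case: (leqP j K) => jK; last first.
  rewrite c0 // big_nat_cond big1 // => i /andP[/andP[i1 iK] _].
  by rewrite (_ : (j <= i)%N = false) //; lia.
(* Only values from [j] on are counted, so the sum is cut at [j] and its lower piece vanishes. *)
rewrite (@big_cat_nat _ _ _ j) //=; last by lia.
rewrite big_nat_cond big1 ?add0n; last first.
  by move=> i /andP[/andP[i1 iK] _]; rewrite (_ : (j <= i)%N = false) //; lia.
rewrite (eq_big_nat _ _ (F2 := fun i => c i - c i.+1)%N); last first.
  by move=> i /andP[ji _]; rewrite ji mul1n.
suff H n : (\sum_(j <= i < j + n) (c i - c i.+1) + c (j + n) = c j)%N.
  by have := H (K.+1 - j)%N; rewrite subnKC ?(c0 K.+1) ?addn0 //; exact: leqW.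
elim: n => [|n IH]; first by rewrite addn0 big_geq.
rewrite addnS big_nat_recr /=; last by lia.
by rewrite -addnA subnK // cd //; lia.
Qed.

(** * Sequences of partitions as families of curves *)

Lemma step0 (M : nat) (la : M.-tuple intpart) : step la 0 = part_empty.
Proof. by []. Qed.

Lemma conj_part0 (j : nat) : conj_part part_empty j = 0%N.
Proof. by []. Qed.

Lemma step_inj (M : nat) (la mu : M.-tuple intpart) :
  (forall j k, (0 < j)%N -> (k <= M)%N ->
     conj_part (step la k) j = conj_part (step mu k) j) -> la = mu.
Proof.
move=> h; apply: eq_from_tnth => k.
rewrite !(tnth_nth part_empty); apply: conj_part_inj => j j0.
exact: (h j k.+1 j0 (ltn_ord k)).
Qed.

Lemma chain_conj (M : nat) (la : M.-tuple intpart) : chain la <->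
  forall j k, (0 < j)%N -> (k < M)%N -> (conj_part (step la k) j <=
    conj_part (step la k.+1) j <= (conj_part (step la k) j).+1)%N.
Proof.
split=> [h j k j0 kM|h k kM]; first by have /interlace_conj := h k kM; exact.
by apply/interlace_conj => j j0; exact: h.
Qed.

(** Each time slice is the conjugate of some partition; choice collects these, and the 0-or-1
    increments of [c] in time are exactly interlacing. *)
Lemma exists_chain (M : nat) (c : nat -> nat -> nat) (K : nat) :
  (forall j, c 0%N j = 0%N) ->
  (forall j k, (0 < j)%N -> (k <= M)%N -> (c k j.+1 <= c k j)%N) ->
  (forall j k, (K < j)%N -> (k <= M)%N -> c k j = 0%N) ->
  (forall j k, (0 < j)%N -> (k < M)%N -> (c k j <= c k.+1 j <= (c k j).+1)%N) ->
  exists mu : M.-tuple intpart, chain mu /\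
    forall j k, (0 < j)%N -> (k <= M)%N -> conj_part (step mu k) j = c k j.
Proof.
move=> c0 cd cK cs.
have /choice[p hp] : forall k, exists la, (k <= M)%N ->
    forall j, (0 < j)%N -> conj_part la j = c k j.
  move=> k; case: (leqP k M) => [kM|_]; last by exists part_empty.
  have [la hla] := @exists_conj_part (c k) K (fun j j0 => cd j k j0 kM)
    (fun j Kj => cK j k Kj kM).
  by exists la.
pose mu := [tuple p (nat_of_ord i).+1 | i < M].
have hmu j k : (0 < j)%N -> (k <= M)%N -> conj_part (step mu k) j = c k j.
  case: k => [|k] j0 kM; first by rewrite step0 conj_part0 c0.
  rewrite /step /= -(hp k.+1) //; congr (conj_part _ _).
  by have := tnth_nth part_empty mu (Ordinal kM); rewrite tnth_mktuple.
exists mu; split=> //; apply/chain_conj => j k j0 kM.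
by rewrite !hmu // ?cs // ltnW.
Qed.

Lemma conj_part_big (la : intpart) (j : nat) : (weight la < j)%N ->
  conj_part la j = 0%N.
Proof.
move=> hj; apply/eqP; rewrite -leqn0 leqNgt -has_count.
apply/hasPn => p /perm_to_rem /perm_sumn /= E; move: hj; rewrite /weight E; lia.
Qed.

(** One bound serves all times, so that products over all curves can be written as finite
    products. *)
Lemma step_conj_big (M : nat) (la : M.-tuple intpart) : exists K : nat,
  forall j k, (K < j)%N -> (k <= M)%N -> conj_part (step la k) j = 0%N.
Proof.
exists (\max_(k < M.+1) weight (step la k)) => j k Kj kM.
apply: conj_part_big; apply: leq_ltn_trans Kj.
by rewrite -ltnS in kM; exact: (leq_bigmax (Ordinal kM)).
Qed.

(** The curve of a fixed sequence, with the sequences themselves as sample space;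
    [conj_ensemble lam j w] is convertible to [conj_path (lam w) j]. *)
Definition conj_path {M : nat} (la : M.-tuple intpart) (j : nat) : int -> int :=
  conj_ensemble id j la.

Lemma conj_pathE {M : nat} (la : M.-tuple intpart) (j k : nat) : (k <= M)%N ->
  conj_path la j k%:Z = (conj_part (step la k) j)%:Z.
Proof. by move=> kM; rewrite /conj_path /conj_ensemble lez_nat kM. Qed.

Lemma path_ext (M : nat) (l l' : int -> int) :
  (forall k, ~ zinterval 0 M%:Z k -> l k = 0) ->
  (forall k, ~ zinterval 0 M%:Z k -> l' k = 0) ->
  (forall k : nat, (k <= M)%N -> l k%:Z = l' k%:Z) -> l = l'.
Proof.
move=> h h' e; apply/funext => k.
have [kM|kM] := pselect (zinterval 0 M%:Z k); last by rewrite h // h'.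
by case: k kM => k /andP[//= _ kM]; exact: e.
Qed.

Lemma conj_path_out {M : nat} (la : M.-tuple intpart) (j : nat) (k : int) :
  ~ zinterval 0 M%:Z k -> conj_path la j k = 0.
Proof. by rewrite /conj_path /conj_ensemble; case: ifP. Qed.

Lemma conj_path_inj (M : nat) (la mu : M.-tuple intpart) :
  (forall j, (0 < j)%N -> conj_path la j = conj_path mu j) -> la = mu.
Proof.
move=> h; apply: step_inj => j k j0 kM; apply/eqP.
by rewrite -eqz_nat -!conj_pathE // h.
Qed.

Lemma upright_conj_path (M : nat) (la : M.-tuple intpart) (j : nat) :
  chain la -> (0 < j)%N -> upright_path 0 M%:Z (conj_path la j).
Proof.
move=> /chain_conj cla j0; split=> [[k|k] // /andP[_ kM]|]; last first.
  exact: conj_path_out.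
have {}kM : (k < M)%N by [].
rewrite -PoszD addn1 !conj_pathE //; last exact: ltnW.
have := cla j k j0 kM; lia.
Qed.

(** * The process weight factored over pairs of adjacent curves *)

Section Weights.
Context {R : realType}.
Implicit Type t : R.

Lemma HL_psiE t (mu la : intpart) (K : nat) : interlace mu la ->
  (forall j, (K < j)%N -> conj_part la j = 0%N) ->
  HL_psi t la mu = \prod_(1 <= j < K.+1)
    (if (conj_part mu j.+1 < conj_part la j.+1)%N &&
        (conj_part la j == conj_part mu j) then 1 - t ^+ mult mu j else 1).
Proof.
move=> il hK; rewrite /HL_psi asboolT // mul1r -big_mkcond -[RHS]big_filter.
rewrite [RHS]fsbig_seq ?filter_uniq ?iota_uniq //; apply: eq_fsbigl.
apply/seteqP; split=> j /=; rewrite mem_filter mem_index_iota.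
  move=> [-> [lt /eqP ->]]; rewrite lt /= ltnS leqNgt; apply/negP => Kj.
  (* An index [j] beyond [K] would need [conj_part la j.+1] to be positive. *)
  by move: lt; rewrite hK // ltnS ltnW.
by move=> /andP[/andP[lt /eqP e] /andP[j1 _]].
Qed.

Definition conj_weight {M : nat} t (la : M.-tuple intpart) (j : nat) : R :=
  \prod_(k < M) HL_weight_factor t
    (fun z => conj_path la j z - conj_path la j.+1 z) k.+1%:Z.

(** The multiplicity of [j] at time [k] is the gap between curves [j] and [j.+1]. As each curve
    moves by 0 or 1, [j] lies in the index set of [psi] exactly when this gap drops by 1. *)
Lemma HL_psi_step t (M : nat) (la : M.-tuple intpart) (K k : nat) :
  chain la -> (k < M)%N ->
  (forall j, (K < j)%N -> conj_part (step la k.+1) j = 0%N) ->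
  HL_psi t (step la k.+1) (step la k) =
  \prod_(1 <= j < K.+1) HL_weight_factor t
    (fun z => conj_path la j z - conj_path la j.+1 z) k.+1%:Z.
Proof.
move=> cla kM hK; rewrite (HL_psiE _ _ _ K) //; last exact: cla.
apply: eq_big_nat => j /andP[j0 _]; rewrite /HL_weight_factor.
have -> : k.+1%:Z - 1 = k%:Z by lia.
rewrite !conj_pathE //; try exact: ltnW.
move/chain_conj: cla => cla.
have := (cla j k j0 kM, cla j.+1 k isT kM).
rewrite (conj_partE (step la k) j).
set m := mult _ _; set x := conj_part _ _; set y := conj_part _ _.
set z := conj_part _ _ => -[h1 h2].
rewrite (_ : (x + m)%N%:Z - x%:Z = m%:Z); last by lia.
have -> : ((x < z) && (y == x + m))%N = (m%:Z - (y%:Z - z%:Z) == 1) by lia.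
by case: ifP => _; rewrite ?mul1r ?mul0r ?subr0.
Qed.

Lemma HL_process_pmfE t (M N : nat) (zeta : R) (la : M.-tuple intpart) (K : nat) :
  chain la ->
  (forall j k, (K < j)%N -> (k <= M)%N -> conj_part (step la k) j = 0%N) ->
  HL_process_pmf t N zeta la = ((1 - zeta) / (1 - t * zeta)) ^+ (N * M) *
    (\prod_(1 <= j < K.+1) conj_weight t la j) *
    HL_Q t (step la M) (fun _ : 'I_N => zeta).
Proof.
move=> cla hK; rewrite /HL_process_pmf exchange_big /=; congr (_ * _ * _).
apply: eq_bigr => k _; rewrite /HL_P1 expr1n mulr1.
by apply: HL_psi_step => // j Kj; exact: hK.
Qed.

Lemma fsbig_zinterval (M : nat) (F : int -> R) :
  \big[*%R/1]_(i \in zinterval 1 M%:Z) F i = \prod_(k < M) F k.+1%:Z.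
Proof.
rewrite (fsbig_ord _ _ (fun k => F k.+1%:Z)).
apply: (reindex_fsbig (fun k : nat => k.+1%:Z)); split.
- by move=> k /= kM; apply/andP; split; lia.
- by move=> j k _ _ /= []. 
- by move=> [[|k]|k] //= /andP[_ kM]; exists k.
Qed.

Lemma conj_path_le (M : nat) (la : M.-tuple intpart) (j : nat) (k : int) :
  conj_path la j.+1 k <= conj_path la j k.
Proof.
rewrite /conj_path /conj_ensemble; case: ifP => // _.
by rewrite lez_nat conj_part_le.
Qed.

(* There is no curve above the first one, hence no factor when [i = 1]. *)
Definition upper_weight {M : nat} t (la : M.-tuple intpart) (i : nat) : R :=
  if i == 1%N then 1 else conj_weight t la i.-1.

(** Conjugate parts decrease in their index, so the ordering test in [HL_weight] always succeeds
    here. *)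
Lemma HL_weight_conj_path t (M : nat) (la : M.-tuple intpart) (i : nat) :
  (0 < i)%N ->
  HL_weight t (conj_path la i) (curve (@conj_ensemble _ M id) i.-1 la)
    (conj_path la i.+1) (zinterval 1 M%:Z) =
  upper_weight t la i * conj_weight t la i.
Proof.
case: i => // i _; rewrite /HL_weight asboolT; last first.
  by move=> k _; split; [case: i => // i; exact: conj_path_le|exact: conj_path_le].
rewrite /upper_weight /= eqSS /conj_weight.
by case: i => [|i] /=; rewrite !fsbig_zinterval.
Qed.

Lemma conj_weight_gt0 t (M : nat) (la : M.-tuple intpart) (j : nat) :
  0 < t < 1 -> 0 < conj_weight t la j.
Proof.
move=> /andP[t0 t1]; apply: prodr_gt0 => k _; rewrite /HL_weight_factor.
case: eqP => [e|_]; last by rewrite mul0r subr0.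
rewrite mul1r subr_gt0; set x := (X in t ^ X) in e *.
(* The gap drops by 1 to a non-negative value, so it was at least 1 and its power of [t] is below
   1. *)
have : 0 < x by have := conj_path_le _ la j k.+1%:Z; lia.
case: x {e} => [[|n]|n] // _.
by rewrite -exprnP exprn_ilt1 // ltW.
Qed.

Lemma upper_weight_gt0 t (M : nat) (la : M.-tuple intpart) (i : nat) :
  0 < t < 1 -> 0 < upper_weight t la i.
Proof. by rewrite /upper_weight; case: eqP => // _; exact: conj_weight_gt0. Qed.

(** Curve [i] enters only the gaps numbered [i.-1] and [i]; for [i = 1] the former is outside the
    product. *)
Lemma prod_conj_weight t (M : nat) (la : M.-tuple intpart) (i K : nat) :
  (0 < i <= K)%N ->
  \prod_(1 <= j < K.+1) conj_weight t la j =
  upper_weight t la i * conj_weight t la i *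
  \prod_(1 <= j < K.+1 | (j != i) && (j.+1 != i)) conj_weight t la j.
Proof.
move=> /andP[i0 iK].
rewrite (bigD1_seq i) ?iota_uniq ?mem_index_iota ?i0 //=.
rewrite [in RHS](mulrC (upper_weight _ _ _)) -mulrA; congr (_ * _).
rewrite /upper_weight; case: eqP => [i1|i1].
  rewrite mul1r big_nat_cond [RHS]big_nat_cond; apply: eq_bigl => j; lia.
rewrite -big_filter (bigD1_seq i.-1) ?filter_uniq ?iota_uniq //; last first.
  by rewrite mem_filter mem_index_iota; lia.
rewrite big_filter_cond; congr (_ * _).
rewrite [LHS]big_nat_cond [RHS]big_nat_cond; apply: eq_bigl => j; lia.
Qed.

(** The two sequences share their last partition, hence the [Q] factor, and every gap not involving
    curve [i]. Cross-multiplying avoids division by the weights. *)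
Lemma HL_process_pmf_swap t (M N : nat) (zeta : R) (la mu : M.-tuple intpart)
    (i : nat) : chain la -> chain mu -> (0 < i)%N ->
  (forall j, (0 < j)%N -> j != i -> conj_path mu j = conj_path la j) ->
  conj_path mu i M%:Z = conj_path la i M%:Z ->
  HL_process_pmf t N zeta mu * (upper_weight t la i * conj_weight t la i) =
  HL_process_pmf t N zeta la * (upper_weight t mu i * conj_weight t mu i).
Proof.
move=> cla cmu i0 ne eM.
have eqM : step mu M = step la M.
  apply: conj_part_inj => j j0; apply/eqP; rewrite -eqz_nat -!conj_pathE //.
  by have [->|/(ne j j0) ->] := eqVneq j i; [rewrite eM|].
have [[K1 h1] [K2 h2]] := (step_conj_big M la, step_conj_big M mu).
(* A common cutoff for both products that also keeps the factor of index [i]. *)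
pose K := maxn i (maxn K1 K2).
rewrite (HL_process_pmfE _ _ _ _ la K) //; last first.
  by move=> j k jK kM; apply: h1 => //; lia.
rewrite (HL_process_pmfE _ _ _ _ mu K) //; last first.
  by move=> j k jK kM; apply: h2 => //; lia.
rewrite eqM !(prod_conj_weight _ _ _ i K); try lia.
have -> : \prod_(1 <= j < K.+1 | (j != i) && (j.+1 != i)) conj_weight t mu j =
    \prod_(1 <= j < K.+1 | (j != i) && (j.+1 != i)) conj_weight t la j.
  rewrite big_nat_cond [RHS]big_nat_cond; apply: eq_bigr => j.
  move=> /andP[/andP[j1 _] /andP[ji ji']].
  by rewrite /conj_weight !ne.
by ring.
Qed.

End Weights.

(** * Replacing one curve, and finiteness of the set of bridges *)

Lemma upright_path_nat (M : nat) (l : int -> int) (k : nat) :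
  upright_path 0 M%:Z l -> (k < M)%N ->
  l k.+1%:Z = l k%:Z \/ l k.+1%:Z = l k%:Z + 1.
Proof.
move=> [h _] kM; have : 0 <= k%:Z < M%:Z by lia.
by move=> /h; rewrite -PoszD addn1; lia.
Qed.

Lemma replace_conj_path (M : nat) (la : M.-tuple intpart) (i : nat)
    (l : int -> int) : chain la -> (0 < i)%N -> upright_path 0 M%:Z l -> l 0 = 0 ->
  (forall k : nat, (0 < k <= M)%N -> (conj_path la i.+1 k%:Z <= l k%:Z) &&
     ((i == 1%N) || (l k%:Z <= conj_path la i.-1 k%:Z))) ->
  exists mu : M.-tuple intpart, [/\ chain mu, conj_path mu i = l &
    forall j, (0 < j)%N -> j != i -> conj_path mu j = conj_path la j].
Proof.
move=> cla i0 ul l0 hl.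
have [K hK] := step_conj_big M la.
(* The absolute value loses nothing: [l] lies above curve [i.+1], which is non-negative. *)
pose c k j := if j == i then `|l k%:Z|%N else conj_part (step la k) j.
have {}hl k : (k <= M)%N -> (conj_part (step la k) i.+1 <= `|l k%:Z|)%N /\
    (i != 1 -> `|l k%:Z| <= conj_part (step la k) i.-1)%N /\ 0 <= l k%:Z.
  case: k => [|k] kM; first by rewrite l0.
  have := hl k.+1; rewrite kM !conj_pathE // => /(_ isT).
  by case: (i == 1%N); lia.
(* The cutoff must reach [i], since the new curve may be non-zero even where the old one
   vanished. *)
have [||||mu [cmu hmu]] := @exists_chain M c (maxn i K).
- by move=> j; rewrite /c l0; case: eqP.
- move=> j k j0 kM; have [h1 [h2 _]] := hl k kM; rewrite /c.
  have := conj_part_le (step la k) _ _ (leqnSn j).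
  case: (eqVneq j i) => [->|ji]; first by rewrite ifN //; lia.
  case: (eqVneq j.+1 i) => [e|//]; move: h2; rewrite -e /=; lia.
- move=> j k Kj kM; rewrite /c ifN; last by lia.
  by apply: hK => //; lia.
- move=> j k j0 kM; rewrite /c; case: eqP => [_|_].
    have := upright_path_nat _ _ _ ul kM.
    by have [[_ [_ h1]] [_ [_ h2]]] := (hl k (ltnW kM), hl _ kM); lia.
  by move/chain_conj: cla; exact.
exists mu; split=> // [|j j0 ji].
  apply: path_ext; [exact: conj_path_out|exact: ul.2|] => k kM.
  by rewrite conj_pathE // hmu // /c eqxx; have [_ [_]] := hl k kM; lia.
apply: path_ext; [exact: conj_path_out|exact: conj_path_out|] => k kM.
by rewrite !conj_pathE // hmu // /c (negbTE ji).
Qed.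

Lemma finite_path_bridge (M : nat) (a b : int) :
  finite_set (path_bridge 0 M%:Z a b).
Proof.
(* A bridge is rebuilt from its start [a] and the set of its up-steps, so there are at most as many
   bridges as subsets of the [M] steps. *)
pose h (s : {ffun 'I_M -> bool}) (k : int) : int :=
  if 0 <= k <= M%:Z then a + \sum_(j < M | (j < `|k|)%N) (s j : nat)%:Z else 0.
apply: (@sub_finite_set _ _ (range h)); last first.
  by apply: finite_image; exact: finite_finset.
move=> l [ul [la _]]; exists [ffun j : 'I_M => l j.+1%:Z != l j%:Z] => //.
apply: (path_ext M); [by move=> k nk; rewrite /h ifF //; apply/negP|exact: ul.2|].
move=> k kM; rewrite /h ifT; last by lia.
rewrite /=; elim: k kM => [|k IH] kM; first by rewrite big_pred0 ?addr0.
rewrite (bigD1 (Ordinal kM)) //= ffunE /= addrCA.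
rewrite (eq_bigl (fun j : 'I_M => (j < k)%N)); last first.
  by move=> j; rewrite ltnS -val_eqE /= ltn_neqAle andbC.
rewrite IH; last exact: ltnW.
by have [->|->] := upright_path_nat _ _ _ ul kM; case: eqP; lia.
Qed.

(** * Sums over countable sets and countably valued random variables *)

Lemma esum_pZl (R : realType) (I : choiceType) (K : set I) (c : R) (p : I -> \bar R) : 0 < c ->
  (forall x, (0 <= p x)%E) ->
  (\esum_(x in K) (c%:E * p x) = c%:E * \esum_(x in K) p x)%E.
Proof.
move=> c0 p0; rewrite /esum -ereal_sup_pZl // image_comp; congr ereal_sup.
by apply: eq_imagel => D _ /=; rewrite ge0_mule_fsumr.
Qed.

Section CountableValued.
Context {R : realType} {d : measure_display} {T : measurableType d}.
Variables (P : probability T R) (X : countType) (Y : T -> X).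
Hypothesis mY : forall x, measurable [set w | Y w = x].

Lemma measurable_countable_preimage (K : set X) : measurable [set w | K (Y w)].
Proof.
have -> : [set w | K (Y w)] = \bigcup_x [set w | Y w = x /\ K x].
  apply/seteqP; split=> w /=; first by exists (Y w).
  by move=> [x _ [->]].
apply: countable_bigcupT_measurable; first exact: countableP.
move=> x; have [Kx|nKx] := pselect (K x).
  by rewrite (_ : mkset _ = [set w | Y w = x]) //; apply/seteqP; split=> w //= [].
by rewrite (_ : mkset _ = set0) //; apply/seteqP; split=> w //= [].
Qed.

Lemma probability_esum (K : set X) :
  P [set w | K (Y w)] = \esum_(x in K) P [set w | Y w = x].
Proof.
(* Numbering the values by [pickle] turns the event into a disjoint union over naturals, where
   countable additivity applies. *)
have -> : [set w | K (Y w)] =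
    \bigcup_(n in pickle @` K) [set w | pickle (Y w) = n].
  apply/seteqP; split=> w /=; first by move=> Kw; exists (pickle (Y w)) => //; exists (Y w).
  by move=> [_ [x Kx <-] /= /(pcan_inj pickleK) ->].
rewrite measure_bigcup /=; last 2 first.
- by move=> n _; exact: (measurable_countable_preimage [set x | pickle x = n]).
- by move=> m n _ _ [w [/= <- <-]].
rewrite nneseries_esum // set_mem_set esum_image; last first.
  by move=> x y _ _ /(pcan_inj pickleK).
apply: eq_esum => x _; congr (P _); apply/seteqP; split=> w /=; last by move=> ->.
exact: (pcan_inj pickleK).
Qed.

(** The sum over [K2] is reindexed along [e], and the constant ratio is pulled out. It will be
    applied to the fibers of two bridges. *)
Lemma probability_proportional (K1 K2 : set X) (e : X -> X) (c : R) :
  0 < c -> set_bij K1 K2 e ->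
  (forall x, K1 x -> P [set w | Y w = e x] = (c%:E * P [set w | Y w = x])%E) ->
  P [set w | K2 (Y w)] = (c%:E * P [set w | K1 (Y w)])%E.
Proof.
move=> c0 eb h; rewrite !probability_esum (reindex_esum _ _ _ _ eb) -esum_pZl //.
exact: eq_esum.
Qed.

End CountableValued.

(** * Sequences with a prescribed curve and prescribed neighbours *)

Section Fiber.
Variables (M i : nat) (f : option (int -> int)) (g : int -> int).

(* The sequences with [L_i = l], whose upper neighbour [L_(i-1)] is [f] ([None]
   when [i = 1]) and whose lower neighbour [L_(i+1)] is [g]. *)
Definition fiber (l : int -> int) : set (M.-tuple intpart) :=
  [set la | [/\ chain la, conj_path la i = l,
     curve (@conj_ensemble _ M id) i.-1 la = f & conj_path la i.+1 = g]].

(** This is the ordering test in [HL_weight] for times 1 to [M]; when it fails, the weight is 0. *)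
Definition between (l : int -> int) : Prop := forall k, zinterval 1 M%:Z k ->
  (if f is Some f' then l k <= f' k else True) /\ g k <= l k.

Lemma fiber_between (l : int -> int) (la : M.-tuple intpart) :
  (0 < i)%N -> fiber l la -> between l.
Proof.
rewrite /between => i0 [_ <- <- <-] k _; split; last exact: conj_path_le.
by case: i i0 => // -[|j] //= _; exact: conj_path_le.
Qed.

Lemma HL_weight_fiber (R : realType) (t : R) (l : int -> int)
    (la : M.-tuple intpart) : (0 < i)%N -> fiber l la ->
  HL_weight t l f g (zinterval 1 M%:Z) = upper_weight t la i * conj_weight t la i.
Proof. by move=> i0 [_ <- <- <-]; exact: HL_weight_conj_path. Qed.

Lemma fiber_replace (a b : int) (l l' : int -> int) (la : M.-tuple intpart) :
  (0 < i)%N -> path_bridge 0 M%:Z a b l -> path_bridge 0 M%:Z a b l' ->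
  between l' -> fiber l la ->
  exists2 mu, fiber l' mu &
    forall j, (0 < j)%N -> j != i -> conj_path mu j = conj_path la j.
Proof.
move=> i0 [_ [la_ _]] [ul' [l'a _]] bl' [cla ell ef eg].
(* Both bridges start at [a], and [a] is 0 because [la] starts at the empty partition. *)
have l'0 : l' 0 = 0 by rewrite l'a -la_ -ell conj_pathE // step0 conj_part0.
have [|mu [cmu emu ne]] := replace_conj_path M la i l' cla i0 ul' l'0.
  move=> k kM; have : zinterval 1 M%:Z k%:Z by apply/andP; split; lia.
  move=> /bl'; rewrite eg -ef => -[h ->] /=.
  by case: i i0 h => // -[|j].
exists mu => //; split=> //; last by rewrite ne //; lia.
rewrite -ef; case: i i0 ne => // -[|j] //= _ ne; congr Some.
by apply: ne => //; lia.
Qed.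

(** Curve [i] is constant on each fiber and the other curves are preserved, which gives injectivity;
    surjectivity comes from replacing [l'] back by [l]. *)
Lemma fiber_bij (a b : int) (l l' : int -> int) : (0 < i)%N ->
  path_bridge 0 M%:Z a b l -> path_bridge 0 M%:Z a b l' ->
  between l -> between l' ->
  exists2 e, set_bij (fiber l) (fiber l') e & forall la, fiber l la ->
    forall j, (0 < j)%N -> j != i -> conj_path (e la) j = conj_path la j.
Proof.
move=> i0 bl bl' hl hl'.
have /choice[e he] : forall la, exists mu, fiber l la -> fiber l' mu /\
    forall j, (0 < j)%N -> j != i -> conj_path mu j = conj_path la j.
  move=> la; have [Kla|] := pselect (fiber l la); last by exists la.
  by have [mu Kmu ne] := fiber_replace _ _ _ _ _ i0 bl bl' hl' Kla; exists mu.
exists e => [|la /he[]//]; split.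
- by move=> la /he[].
- move=> la mu; rewrite !inE => Kla Kmu ee; apply: conj_path_inj => j j0.
  have [->|ji] := eqVneq j i; first by have [[_ -> _ _] [_ -> _ _]] := (Kla, Kmu).
  by rewrite -(he la Kla).2 // ee (he mu Kmu).2.
- move=> mu Kmu; have [la Kla ne] := fiber_replace _ _ _ _ _ i0 bl' bl hl Kmu.
  exists la => //; have [[_ ee _ _] ne'] := he la Kla.
  apply: conj_path_inj => j j0; have [->|ji] := eqVneq j i.
    by rewrite ee; have [_ ->] := Kmu.
  by rewrite ne' // ne.
Qed.

End Fiber.

(** * The conditional law of one curve *)

Lemma HL_process_sample_measurable (R : realType) (d : measure_display)
    (T : measurableType d) (P : probability T R) (M N : nat) (zeta t : R)
    (lam : T -> M.-tuple intpart) : HL_process_sample t P N zeta lam ->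
  forall la, measurable [set w | lam w = la].
Proof.
move=> [clam plam] la; have [/plam[]//|ncla] := pselect (chain la).
rewrite (_ : mkset _ = set0) //; apply/seteqP; split=> w //= e.
by apply: ncla; rewrite -e.
Qed.

(** The sequence [la] witnesses that the fiber of [l] is non-empty, so its weight is positive and
    the ratio is meaningful. *)
Lemma probability_fiber (R : realType) (d : measure_display)
    (T : measurableType d) (P : probability T R) (M N : nat) (zeta t : R)
    (lam : T -> M.-tuple intpart) (i : nat) (f : option (int -> int))
    (g : int -> int) (a b : int) (l l' : int -> int) (la : M.-tuple intpart) :
  0 < t < 1 -> HL_process_sample t P N zeta lam -> (0 < i)%N ->
  path_bridge 0 M%:Z a b l -> path_bridge 0 M%:Z a b l' -> fiber M i f g l la ->
  P [set w | fiber M i f g l' (lam w)] =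
  ((HL_weight t l' f g (zinterval 1 M%:Z) / HL_weight t l f g (zinterval 1 M%:Z))%:E
    * P [set w | fiber M i f g l (lam w)])%E.
Proof.
move=> ht hlam i0 bl bl' Kla.
have wpos l0 mu : fiber M i f g l0 mu ->
    0 < HL_weight t l0 f g (zinterval 1 M%:Z).
  move=> Kmu; rewrite (HL_weight_fiber _ _ _ _ _ _ _ _ i0 Kmu) mulr_gt0 //.
    exact: upper_weight_gt0.
  exact: conj_weight_gt0.
(* If [l'] crosses a neighbour, its fiber is empty and its weight is 0, so both sides vanish. *)
have [hl'|nl'] := pselect (between M f g l'); last first.
  rewrite [X in X / _](_ : _ = 0); last by rewrite /HL_weight asboolF.
  rewrite mul0r mul0e (_ : mkset _ = set0) ?measure0 //.
  by apply/seteqP; split=> w //= /(fiber_between _ _ _ _ _ _ i0).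
have [e eb ne] := fiber_bij _ _ _ _ _ _ _ _ i0 bl bl'
  (fiber_between _ _ _ _ _ _ i0 Kla) hl'.
have [ef _ _] := eb.
apply: (probability_proportional P _ _
  (HL_process_sample_measurable _ _ _ _ _ _ _ _ _ hlam) _ _ e) => //.
  by apply: divr_gt0; [exact: wpos (ef _ Kla)|exact: wpos Kla].
move=> mu Kmu; have [_ plam] := hlam.
have Kemu := ef _ Kmu; have [cmu lmu _ _] := Kmu; have [cemu lemu _ _] := Kemu.
rewrite (plam _ cmu).2 (plam _ cemu).2 -EFinM; congr (_%:E).
have := HL_process_pmf_swap t M N zeta mu (e mu) i cmu cemu i0 (ne _ Kmu).
rewrite -(HL_weight_fiber _ _ _ _ _ _ _ _ i0 Kmu).
rewrite -(HL_weight_fiber _ _ _ _ _ _ _ _ i0 Kemu).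
rewrite lmu lemu bl.2.2 bl'.2.2 => /(_ erefl) E.
have w0 := wpos _ _ Kmu.
apply: (mulIf (lt0r_neq0 w0)); rewrite E.
by field; exact: lt0r_neq0.
Qed.

Theorem proposition3p9 (R : realType) (d : measure_display)
    (T : measurableType d) (P : probability T R) (M N : nat) (zeta t : R)
    (hM : (0 < M)%N) (hN : (0 < N)%N)
    (hzeta : 0 < zeta < 1) (ht : 0 < t < 1)
    (lam : T -> M.-tuple intpart)
    (hlam : HL_process_sample t P N zeta lam) :
  discrete_line_ensemble N 0 M%:Z (conj_ensemble lam) /\
  HL_Gibbs t P N 0 M%:Z (conj_ensemble lam) (zinterval 1 M%:Z).
Proof.
have clam := hlam.1; have mlam := HL_process_sample_measurable _ _ _ _ _ _ _ _ _ hlam.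
split.
  move=> j /andP[j0 _]; split=> [w|k m]; first exact: (upright_conj_path _ _ _ (clam w) j0).
  exact: (measurable_countable_preimage _ _ mlam [set la | conj_path la j k = m]).
move=> i f g a b /andP[i0 _] _ _ B PB l bl.
set S := zinterval 1 M%:Z; pose D := path_bridge 0 M%:Z a b.
pose A m := [set w | fiber M i f g m (lam w)].
have mA m : measurable (A m) by exact: (measurable_countable_preimage _ _ mlam).
have BE m : D m -> [set w | conj_ensemble lam i w = m] `&` B = A m.
  move=> [_ [ma mb]]; apply/seteqP; split=> w /=.
    by move=> [em [_ [_ [ef eg]]]]; split.
  by move=> [_ em ef eg]; split=> //; split; [rewrite -ma -em|split; [rewrite -mb -em|split]].
(* The conditioning event splits into disjoint events, one for each of the finitely many bridges. *)
have BD : B = \bigcup_(m in D) A m.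
  apply/seteqP; split=> w.
    move=> [wa [wb [ef eg]]]; exists (conj_path (lam w) i); last by split.
    by split; [exact: upright_conj_path|split].
  by move=> [m Dm Aw]; have := BE m Dm => /seteqP[_ /(_ w Aw)] [].
have finD : finite_set D := finite_path_bridge M a b.
have PBE : P B = \sum_(m \in D) P (A m).
  rewrite BD -fsbig_setU // measure_fsbig //.
  by move=> m m' _ _ [w [/= [_ <- _ _] [_ <- _ _]]].
have [w0 Bw0] : exists w, B w.
  by apply/set0P/eqP => B0; move: PB; rewrite B0 measure0 ltxx.
(* Positivity of [P B] supplies a reference bridge [l0] with non-empty fiber, against which all
   other bridges are compared. *)
have [l0 Dl0 Al0] : (\bigcup_(m in D) A m) w0 by rewrite -BD.
pose W m := HL_weight t m f g S.
(* The common ratio of probability to weight; it cancels in the conditional probability and is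
   non-zero because [P B] is positive. *)
pose c := fine (P (A l0)) / W l0.
have PA m : D m -> P (A m) = (c * W m)%:E.
  move=> Dm; rewrite (probability_fiber _ _ _ _ _ _ _ _ _ _ _ _ _ _ _ _ _ ht hlam i0 Dl0 Dm Al0).
  rewrite -[X in (_ * X)%E]fineK ?fin_num_measure //; last exact: mA.
  rewrite -EFinM; congr (_%:E).
  by rewrite /c [RHS]mulrAC mulrC mulrA.
have {}PBE : P B = (c * \sum_(m \in D) W m)%:E.
  rewrite PBE mulr_fsumr -fsumEFin //; apply: eq_fsbigr => m; rewrite inE; exact: PA.
rewrite /cond_prob BE // PA // PBE /=.
have : c * \sum_(m \in D) W m != 0 by apply: lt0r_neq0; rewrite -lte_fin -PBE.
rewrite mulf_eq0 => /norP[c0 _].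
by rewrite -mulf_div divff // mul1r.
Qed.
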